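(* Let $n\in\mathbb N\cup\{\infty\}$, let $k^i\ge 0$ ($1\le i\le n$) satisfy $\sum_i e^{-k^i}\le 1$, let $T\ge1$, let $s_1,\dots,s_T\in[0,1]^n$ be a fixed sequence of loss vectors, and let $\ell_t$ be the expected loss at time $t$ of the FPL (Follow the Perturbed Leader) algorithm run with learning rates $\eta_t>0$, with $\ell_{<t}=\ell_1+\dots+\ell_{t-1}$ and $\ell_{1:T}=\ell_1+\dots+\ell_T$. (i) If $\eta_t=1/\sqrt{2(\ell_{<t}+1)}$ for all $t$, then $$\ell_{1:T}\le s_{1:T}^i+(k^i+1)\sqrt{2(s_{1:T}^i+1)}+2(k^i+1)^2\qquad\text{for all } i.$$ (ii) If $\eta_t=\sqrt{\dfrac{K}{2(\ell_{<t}+1)}}$ for all $t$, where $K>0$ satisfies $k^i\le K$ for all $i$, then $$\ell_{1:T}\le s_{1:T}^i+2\sqrt{2(s_{1:T}^i+1)K}+8K\qquad\text{for all } i.$$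
   Context: Experts are indexed by $i$ with $1\le i\le n$ (all $i\in\mathbb N$ if $n=\infty$). $s_t^i\in[0,1]$ is the loss of expert $i$ at time $t$, $s_{1:t}^i=s_1^i+\dots+s_t^i$, $s_{<t}^i=s_1^i+\dots+s_{t-1}^i$ (so $s_{<1}^i=0$). The number $k^i$ is called the complexity of expert $i$. FPL: let $q=(q^i)_{1\le i\le n}$ have independent components, each exponentially distributed with rate 1 (density $e^{-x}$, $x\ge0$), drawn once at the beginning. At time $t$, FPL with learning rate $\eta_t$ selects the expert $$I_t=\arg\min_{i}\Big\{s_{<t}^i+\frac{k^i-q^i}{\eta_t}\Big\}$$ (the minimum is attained, uniquely, almost surely). Its expected loss at time $t$ is $\ell_t=E[s_t^{I_t}]$. The learning rate $\eta_t$ may depend on the (deterministic) quantities $\ell_1,\dots,\ell_{t-1}$, so that $\eta_t$ and $\ell_t$ are defined recursively; $\ell_{<1}=0$. *)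

(* Defs.v *)
From HB Require Import structures.
From mathcomp Require Import all_boot all_order all_algebra.
From mathcomp Require Import all_classical all_reals all_analysis.

Set Implicit Arguments.
Unset Strict Implicit.
Unset Printing Implicit Defensive.

Import Order.TTheory GRing.Theory Num.Theory.
Import numFieldNormedType.Exports.

Local Open Scope classical_set_scope.
Local Open Scope ring_scope.

(* [None] stands for n = oo; experts are numbered from 0 instead of 1, so the
   components of a family [nat -> R] outside [experts n] are junk. *)
Definition experts (n : option nat) : pred nat :=
  fun i => if n is Some m then (i < m)%N else true.

(* Mutual independence of the subfamily of X indexed by J. *)
Definition independent_on (d d' : measure_display) (Omega : measurableType d)
    (T' : measurableType d') (R : realType) (P : probability Omega R)
    (I : eqType) (J : pred I) (X : I -> {RV P >-> T'}) : Prop :=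
  forall (F : seq I) (B : I -> set T'),
    uniq F -> {in F, forall i, J i} -> {in F, forall i, measurable (B i)} ->
    P (\bigcap_(i in [set` F]) (X i @^-1` B i)) =
    (\prod_(i <- F) P (X i @^-1` B i))%E.

Definition is_argmin (R : realType) (A : pred nat) (f : nat -> R) (i : nat) :
    Prop :=
  A i /\ forall j, A j -> f i <= f j.

(* The least minimizer; the value is 0 if the minimum is not attained. Both
   conventions only matter on a null set for the perturbed scores below. *)
Definition argmin (R : realType) (A : pred nat) (f : nat -> R) : nat :=
  xget 0%N [set i | is_argmin A f i /\
                    forall j, is_argmin A f j -> (i <= j)%N].

(* I_t, where eta is the learning rate at time t and q is the realization of
   the perturbation; s u i is the loss of expert i at time u, with u >= 1. *)
Definition fpl_choice (R : realType) (n : option nat) (k : nat -> R)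
    (s : nat -> nat -> R) (eta : R) (t : nat) (q : nat -> R) : nat :=
  argmin (experts n) (fun i => \sum_(1 <= u < t) s u i + (k i - q i) / eta).

Definition fpl_expected_loss (d : measure_display) (Omega : measurableType d)
    (R : realType) (P : probability Omega R) (q : nat -> {RV P >-> R})
    (n : option nat) (k : nat -> R) (s : nat -> nat -> R) (eta : R) (t : nat) :
    \bar R :=
  ('E_P[fun w => s t (fpl_choice n k s eta t (fun i => q i w))])%E.

(* Main.v *)
(* Idea: compare FPL with its lookahead variant, which at time t also sees s_t.
   By memorylessness of the exponential law, adding a loss in [0,1] to the
   scores changes the probability of selecting a given expert by a factor at
   most e^(eta_t), so the lookahead variant loses r_t >= (1 - eta_t) l_t. A
   "be the leader" induction bounds the sum of the r_t by
   s^i_{1:T} + (k^i - q^i + max_j (q^j - k^j)^+) / eta_T. The random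
   terms contribute at most 0 in expectation, because E q^i = 1 while
   sum_j E (q^j - k^j)^+ = sum_j e^(-k^j) <= 1.
   Finally the sum of eta_t l_t telescopes against the square root of l_{1:T},
   and the resulting quadratic inequality in that square root is solved. *)

Require Import Defs.
From HB Require Import structures.
From mathcomp Require Import all_boot all_order all_algebra.
From mathcomp Require Import all_classical all_reals all_analysis.
From mathcomp Require Import measurable_realfun.
From mathcomp Require Import lra.

Set Implicit Arguments.
Unset Strict Implicit.
Unset Printing Implicit Defensive.

Import Order.TTheory GRing.Theory Num.Theory.
Import numFieldNormedType.Exports.

Local Open Scope classical_set_scope.
Local Open Scope ring_scope.

(** * Square-root inequalities for self-confident learning rates *)

(** With [z = sqrt (2 * L)] and [w = sqrt (2 * S)] the hypothesis is the quadratic inequality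
    $z^2\le w^2+2cz$. It forces $z\le w+2c$, and inserting this bound into [S + c * z] gives the
    claim. *)
Lemma le_selfbounded (R : realType) (c S L : R) : 0 <= c -> 0 <= S -> 0 <= L ->
  L <= S + c * Num.sqrt (2 * L) ->
  L <= S + c * Num.sqrt (2 * S) + 2 * c ^+ 2.
Proof.
move=> c0 S0 L0.
set z := Num.sqrt (2 * L); set w := Num.sqrt (2 * S).
have z2 : z ^+ 2 = 2 * L by rewrite sqr_sqrtr// mulr_ge0.
have w2 : w ^+ 2 = 2 * S by rewrite sqr_sqrtr// mulr_ge0.
have z0 : 0 <= z by exact: sqrtr_ge0.
have w0 : 0 <= w by exact: sqrtr_ge0.
move=> LS.
(* Otherwise $z-2c>w$ and $z>w$, so $z(z-2c)>w^2$. *)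
have zw : z <= w + 2 * c.
  by rewrite leNgt; apply/negP => h; nra.
by have := ler_wpM2l c0 zw; nra.
Qed.

(** From $v^2-u^2=2x$ one gets $v-u=2x/(u+v)$, and $u\le v\le w$ bounds this below by $x/w$. The
    [+ 1] under the root of $w$ makes up for the loss [x] that the learning rate has not seen
    yet. *)
Lemma sqrt_increment (R : realType) (a x : R) : 0 <= a -> 0 <= x <= 1 ->
  Num.sqrt (2 * a) + x / Num.sqrt (2 * (a + 1)) <= Num.sqrt (2 * (a + x)).
Proof.
move=> a0 /andP[x0 x1].
set u := Num.sqrt (2 * a); set v := Num.sqrt (2 * (a + x)).
set w := Num.sqrt (2 * (a + 1)).
have u2 : u ^+ 2 = 2 * a by rewrite sqr_sqrtr//; lra.
have v2 : v ^+ 2 = 2 * (a + x) by rewrite sqr_sqrtr//; lra.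
have u0 : 0 <= u by exact: sqrtr_ge0.
have w0 : 0 < w by rewrite sqrtr_gt0; lra.
have uv : u <= v by rewrite ler_sqrt; lra.
have vw : v <= w by rewrite ler_sqrt; lra.
by rewrite -lerBrDl ler_pdivrMr//; nra.
Qed.

Lemma sum_selfconfident (R : realType) (x : nat -> R) (T : nat) :
  (forall t, (1 <= t <= T)%N -> 0 <= x t <= 1) ->
  \sum_(1 <= t < T.+1) x t / Num.sqrt (2 * (\sum_(1 <= u < t) x u + 1))
    <= Num.sqrt (2 * \sum_(1 <= t < T.+1) x t).
Proof.
elim: T => [|T IH] x01; first by rewrite !big_geq// mulr0 sqrtr0.
rewrite !(@big_nat_recr _ _ _ T.+1)//=.
have xT : 0 <= x T.+1 <= 1 by apply: x01; rewrite leqnn.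
have x01' t : (1 <= t <= T)%N -> 0 <= x t <= 1.
  by move=> /andP[t1 tT]; apply: x01; rewrite t1 ltnW.
apply: le_trans (sqrt_increment _ xT); first by rewrite lerD2r; exact: IH.
by rewrite big_nat sumr_ge0// => t /x01' /andP[].
Qed.

(** * Pathwise regret of the lookahead leader *)

(* Pointwise "be the leader": [J t] minimizes the score which already includes
   the loss at time [t], and [Q] bounds all the [q j - k j]. *)
Lemma lookahead_leader_regret (R : realType) (A : pred nat) (k q : nat -> R)
    (s : nat -> nat -> R) (eta : nat -> R) (J : nat -> nat) (Q : R) (T : nat) :
  (1 <= T)%N -> 0 <= Q -> (forall j, A j -> q j - k j <= Q) ->
  (forall t, (1 <= t <= T)%N -> 0 < eta t) ->
  (forall t, (1 <= t < T)%N -> eta t.+1 <= eta t) ->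
  (forall t, (1 <= t <= T)%N -> is_argmin A
     (fun j => \sum_(1 <= u < t.+1) s u j + (k j - q j) / eta t) (J t)) ->
  forall i, A i ->
  \sum_(1 <= t < T.+1) s t (J t) + q i / eta T <=
    \sum_(1 <= t < T.+1) s t i + (k i + Q) / eta T.
Proof.
move=> T1 Q0 hQ eta0 etam hJ.
(* The induction compares with the current leader [J t]; minimality of [J T] replaces it by [i] only
   at the end. *)
suff main t : (1 <= t <= T)%N -> \sum_(1 <= u < t.+1) s u (J u) <=
    \sum_(1 <= u < t.+1) s u (J t) + (k (J t) - q (J t) + Q) / eta t.
  have hT : (1 <= T <= T)%N by rewrite T1 leqnn.
  move=> i Ai; have := main T hT.
  have [_ /(_ i Ai)] := hJ T hT.
  rewrite !mulrDl !mulNr; lra.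
elim: t => // -[_ h1|t IH /andP[_ tT]].
  rewrite !big_nat1 lerDl divr_ge0//; last exact/ltW/eta0.
  by have [AJ _] := hJ _ h1; have := hQ _ AJ; lra.
have ht : (1 <= t.+1 <= T)%N by rewrite /= ltnW.
have ht2 : (1 <= t.+2 <= T)%N by [].
rewrite big_nat_recr//= [X in _ <= X + _]big_nat_recr//=.
have := IH ht; have [_] := hJ _ ht; have [AJ _] := hJ _ ht2.
move=> /(_ _ AJ).
(* The summand [Q] makes the numerator nonnegative, so lowering the learning rate can only increase
   the quotient. *)
have : (k (J t.+2) - q (J t.+2) + Q) / eta t.+1 <=
       (k (J t.+2) - q (J t.+2) + Q) / eta t.+2.
  apply: ler_wpM2l; first by have := hQ _ AJ; lra.
  by rewrite lef_pV2 ?posrE ?eta0//; exact: etam.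
rewrite !mulrDl !mulNr; lra.
Qed.

(** * Existence and measurability of minimizers *)

Lemma is_argmin_argmin (R : realType) (A : pred nat) (f : nat -> R) :
  (exists i, is_argmin A f i) -> is_argmin A f (argmin A f).
Proof.
move=> [i fi]; rewrite /argmin; case: xgetP => [j _ []//|noleast].
have ex : exists i, `[< is_argmin A f i >] by exists i; apply/asboolP.
case: (ex_minnP ex) => j /asboolP fj jmin.
by have := noleast j; case; split => // m fm; apply: jmin; apply/asboolP.
Qed.

Lemma argmin_least (R : realType) (A : pred nat) (f : nat -> R) (i : nat) :
  is_argmin A f i -> (argmin A f <= i)%N.
Proof.
move=> fi; rewrite /argmin; case: xgetP => [j _ [_]|//]; exact.
Qed.

Lemma argmin_unattained (R : realType) (A : pred nat) (f : nat -> R) :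
  ~ (exists i, is_argmin A f i) -> argmin A f = 0%N.
Proof.
by move=> nex; rewrite /argmin; case: xgetP => // j _ [fj]; case: nex; exists j.
Qed.

Lemma argmin_in (R : realType) (A : pred nat) (f : nat -> R) :
  A 0%N -> A (argmin A f).
Proof.
move=> A0; have [ex|nex] := pselect (exists i, is_argmin A f i).
  by case: (is_argmin_argmin ex).
by rewrite argmin_unattained.
Qed.

Lemma argmin_strict (R : realType) (A : pred nat) (f : nat -> R) (i : nat) :
  A i -> (forall j, A j -> j != i -> f i < f j) -> argmin A f = i.
Proof.
move=> Ai fi.
have mi : is_argmin A f i.
  split=> // j Aj; have [->//|ji] := eqVneq j i; exact/ltW/fi.
have [Am mm] := is_argmin_argmin (ex_intro _ _ mi).
apply/eqP; apply/negPn/negP => ni.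
by have := mm _ Ai; rewrite leNgt fi.
Qed.

Lemma is_argmin_bounded (R : realType) (A : pred nat) (f : nat -> R) (N : nat) :
  (exists2 j, (j < N)%N & A j) ->
  exists i, A i /\ forall j, (j < N)%N -> A j -> f i <= f j.
Proof.
move=> [i0 i0N Ai0].
case: (@arg_minP _ _ 'I_N (Ordinal i0N) (fun i => A i) (fun i => f i) Ai0).
by move=> i Ai im; exists i; split => // j jN Aj; exact: (im (Ordinal jN)).
Qed.

Lemma is_argmin_exists (R : realType) (A : pred nat) (f : nat -> R)
    (i N : nat) : A i ->
  (forall j, (N <= j)%N -> A j -> f i <= f j) -> exists m, is_argmin A f m.
Proof.
move=> Ai fN.
(* The range searched contains [i] itself; beyond it every value is at least [f i], hence at least
   the minimum found. *)
have [|m [Am mm]] := @is_argmin_bounded _ A f (maxn N i.+1).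
  by exists i => //; rewrite leq_max ltnSn orbT.
exists m; split => // j Aj; have [jN|jN] := ltnP j (maxn N i.+1).
  exact: mm.
apply: (@le_trans _ _ (f i)).
  by apply: mm => //; rewrite leq_max ltnSn orbT.
by apply: fN => //; apply: leq_trans jN; rewrite leq_max leqnn.
Qed.

Lemma measurable_is_argmin (d : measure_display) (T : measurableType d)
    (R : realType) (A : pred nat) (f : T -> nat -> R) (i : nat) :
  (forall j, measurable_fun setT (f ^~ j)) ->
  measurable [set w | is_argmin A (f w) i].
Proof.
move=> mf; have [Ai|nAi] := boolP (A i); last first.
  rewrite (_ : mkset _ = set0)//; apply/seteqP; split => w // -[].
  by rewrite (negPf nAi).
rewrite (_ : mkset _ = \bigcap_(j in [set j | A j]) [set w | f w i <= f w j]).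
  apply: bigcap_measurableType => j _; rewrite -[X in measurable X]setTI.
  have /(_ [set true]) := measurable_fun_ler (mf i) (mf j) measurableT.
  by apply.
by apply/seteqP; split => w; [case=> _ h j /= /h|move=> h; split => // j /h].
Qed.

Lemma measurable_argmin (d : measure_display) (T : measurableType d)
    (R : realType) (A : pred nat) (f : T -> nat -> R) (i : nat) :
  (forall j, measurable_fun setT (f ^~ j)) ->
  measurable [set w | argmin A (f w) = i].
Proof.
move=> mf; pose M j := [set w | is_argmin A (f w) j].
have mM j : measurable (M j) by exact: measurable_is_argmin.
(* Either [i] is the least minimizer, or there is none and [i] is the default value 0 of [argmin].
   Both cases are countable combinations of the events [M j]. *)
rewrite (_ : mkset _ =
  (M i `&` \bigcap_(j in [set j | (j < i)%N]) ~` M j) `|`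
  ((if i == 0%N then setT else set0) `&` ~` \bigcup_j M j)).
  apply: measurableU.
    apply: measurableI => //; apply: bigcap_measurableType => j _.
    exact: measurableC.
  apply: measurableI; first by case: ifP.
  by apply: measurableC; exact: bigcupT_measurable.
apply/seteqP; split => w /=.
  move=> ri; have [ex|nex] := pselect (exists i, is_argmin A (f w) i).
    left; split; first by rewrite /M /= -ri; exact: is_argmin_argmin.
    by move=> j /= ji /argmin_least; rewrite ri leqNgt ji.
  right; split; last by move=> [j _ Mj]; apply: nex; exists j.
  by rewrite -ri argmin_unattained.
case=> [[Mi ni]|[]].
  apply/eqP; rewrite eqn_leq argmin_least//= leqNgt; apply/negP => /ni; apply.
  by apply: is_argmin_argmin; exists i.
case: eqP => // -> _ nex; apply: argmin_unattained => -[j Mj].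
by apply: nex; exists j.
Qed.

Lemma measurable_no_argmin (d : measure_display) (T : measurableType d)
    (R : realType) (A : pred nat) (f : T -> nat -> R) :
  (forall j, measurable_fun setT (f ^~ j)) ->
  measurable [set w | ~ exists i, is_argmin A (f w) i].
Proof.
move=> mf; rewrite (_ : mkset _ = ~` \bigcup_i [set w | is_argmin A (f w) i]).
  apply: measurableC; apply: bigcupT_measurable => j.
  exact: measurable_is_argmin.
by apply/seteqP; split => w nw; [case=> j _ Mj|case=> j Mj];
  apply: nw; exists j.
Qed.

Lemma measurable_perturbed_score (d : measure_display) (T : measurableType d)
    (R : realType) (X : T -> R) (a b e : R) : measurable_fun setT X ->
  measurable_fun setT (fun w => a + (b - X w) / e).
Proof.
move=> mX; apply: measurable_funD => //; apply: measurable_funM => //.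
exact: measurable_funB.
Qed.

(** * The exponential law: tails, positive parts, memorylessness *)

Lemma exponential_prob_tail (R : realType) (x : R) : 0 <= x ->
  exponential_prob 1 `[x, +oo[ = (expR (- x))%:E.
Proof.
move=> x0; rewrite /exponential_prob.
have cexpN : continuous (fun z : R => expR (- 1 * z)).
  move=> z; apply: continuous_comp; last exact: continuous_expR.
  by apply: continuousM => //; apply: (@continuousN _ R^o);
    exact: cst_continuous.
rewrite (@ge0_continuous_FTC2y _ _ (fun x => - (expR (- 1 * x))) _ 0)//.
- by rewrite mulN1r EFinN oppeK add0e.
- by move=> y _; exact: exponential_pdf_ge0.
- apply: (@continuous_subspaceW R^o _ _ [set` `[0, +oo[%R]).
    by move=> y; rewrite /= !in_itv/= !andbT; exact: le_trans.
  exact: within_continuous_exponential_pdf.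
- rewrite -oppr0; apply: cvgN.
  under eq_fun do rewrite mulN1r.
  exact: cvgr_expR.
- by apply: cvgN; apply/cvg_at_right_filter; exact: cexpN.
- move=> y; rewrite in_itv/= andbT => xy.
  by apply: derive1_exponential_pdf; rewrite in_itv/= andbT (le_lt_trans x0).
Qed.

Lemma exponential_prob_tail_open (R : realType) (x : R) : 0 <= x ->
  exponential_prob 1 `]x, +oo[ = (expR (- x))%:E.
Proof.
move=> x0; rewrite -exponential_prob_tail// /exponential_prob.
rewrite integral_itv_obnd_cbnd//; apply/measurable_funTS/measurable_EFinP.
exact: measurable_exponential_pdf.
Qed.

Lemma exponential_prob_neg (R : realType) :
  exponential_prob (1 : R) `]-oo, 0[ = 0%E.
Proof.
apply: integral0_eq => x; rewrite /= in_itv/= => x0.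
by rewrite lt0_exponential_pdf.
Qed.

Lemma integral_expRN_shift (R : realType) (k : R) :
  (\int[lebesgue_measure]_(r in `[0%R, +oo[) (expR (- (k + r)))%:E =
   (expR (- k))%:E)%E.
Proof.
transitivity ((expR (- k))%:E * exponential_prob 1 `[0%R, +oo[)%E; last first.
  by rewrite exponential_prob_tail// oppr0 expR0 mule1.
rewrite /exponential_prob -ge0_integralZl//; first last.
- by move=> x _; rewrite lee_fin exponential_pdf_ge0.
- by apply/measurable_funTS/measurable_EFinP; exact: measurable_exponential_pdf.
apply: eq_integral => x; rewrite inE/= in_itv/= andbT => x0.
by rewrite -EFinM exponential_pdfE// mul1r mulN1r -expRD opprD.
Qed.

(** Layer-cake formula: the expectation is the integral over $r\ge0$ of the tail
    $P(X>k+r)=e^{-(k+r)}$. The case [k = 0] supplies the mean 1 of the perturbations. *)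
Lemma expectation_pospart_exponential (d : measure_display)
    (Omega : measurableType d) (R : realType) (P : probability Omega R)
    (X : {RV P >-> R}) (k : R) : 0 <= k ->
  (forall A : set R, measurable A ->
    distribution P X A = exponential_prob 1 A) ->
  (\int[P]_w (Num.max (X w - k) 0)%:E = (expR (- k))%:E)%E.
Proof.
move=> k0 X_exp; pose Y w := Num.max (X w - k) 0.
have mY : measurable_fun setT Y.
  by apply: measurable_maxr => //; apply: measurable_funB.
pose Y' : {RV P >-> R} := mfun_Sub (mem_set mY : Y \in mfun).
have := @ge0_expectation_ccdf _ _ _ P Y'; rewrite unlock => ->; last first.
  by move=> w; rewrite /= le_max lexx orbT.
rewrite -integral_expRN_shift; apply: eq_integral => r.
rewrite inE/= in_itv/= andbT => r0;
  rewrite -exponential_prob_tail_open ?addr_ge0//.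
rewrite -X_exp// /ccdf /distribution /pushforward; congr (P _).
apply/seteqP; split => w /=; rewrite !in_itv/= !andbT lt_max ltrBrDr.
  by case/orP; [rewrite addrC|rewrite ltNge r0].
by rewrite addrC => ->.
Qed.

Lemma exponential_ge (d : measure_display) (Omega : measurableType d)
    (R : realType) (P : probability Omega R) (X : {RV P >-> R}) (a : R) :
  (forall A : set R, measurable A ->
    distribution P X A = exponential_prob 1 A) ->
  0 <= a -> P (X @^-1` `[a, +oo[) = (expR (- a))%:E.
Proof.
by move=> X_exp a0; rewrite -exponential_prob_tail// -X_exp.
Qed.

Lemma exponential_bounded (d : measure_display) (Omega : measurableType d)
    (R : realType) (P : probability Omega R) (X : {RV P >-> R}) (a b : R) :
  (forall A : set R, measurable A ->
    distribution P X A = exponential_prob 1 A) ->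
  0 <= a -> a <= b -> P (X @^-1` `[a, b[) = (expR (- a) - expR (- b))%:E.
Proof.
move=> X_exp a0 ab.
have mX (c : interval R) : measurable (X @^-1` [set` c]) by exact:
  measurable_funPTI.
have CE : X @^-1` `[a, +oo[ `\` X @^-1` `[b, +oo[ = X @^-1` `[a, b[.
  apply/seteqP; split => w /=; rewrite !in_itv/= !andbT.
    by case=> ->; move/negP; rewrite -ltNge.
  by case/andP=> -> wb; split => //; apply/negP; rewrite -ltNge.
have IE : X @^-1` `[a, +oo[ `&` X @^-1` `[b, +oo[ = X @^-1` `[b, +oo[.
  apply/seteqP; split => w /=; rewrite !in_itv/= !andbT; first by case.
  by move=> bw; split => //; exact: le_trans bw.
have : (P (X @^-1` `[a, +oo[) =
    P (X @^-1` `[a, b[) + P (X @^-1` `[b, +oo[))%E.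
  by rewrite -CE -[in X in (_ + X)%E]IE; exact: measureDI.
rewrite !exponential_ge ?(le_trans a0)// EFinB => ->.
by rewrite addeK.
Qed.

(* Discretizing [X] in cells of width [h - h'] replaces the conditioning on
   everything but [X] by the product rule for cylinder events: shifting a cell
   by [h] divides its probability by [expR h]. *)
Lemma exponential_memoryless (d : measure_display) (Omega : measurableType d)
    (R : realType) (P : probability Omega R) (X : {RV P >-> R})
    (E : R -> set Omega) (h' h : R) :
  (forall A : set R, measurable A ->
    distribution P X A = exponential_prob 1 A) ->
  (forall x, measurable (E x)) -> (forall x y, x <= y -> E x `<=` E y) ->
  (forall A x, measurable A ->
    P (X @^-1` A `&` E x) = (P (X @^-1` A) * P (E x))%E) ->
  measurable [set w | E (X w) w] -> measurable [set w | E (X w - h') w] ->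
  0 <= h' -> h' < h ->
  (P [set w | E (X w) w] <= (expR h)%:E * P [set w | E (X w - h')%R w])%E.
Proof.
move=> X_exp mE Emono EX mS mS' h'0 hh.
(* The gap between [h'] and [h] is what leaves room for cells of positive width. *)
pose dl := h - h'; have dl0 : 0 < dl by rewrite subr_gt0.
have mX (c : interval R) : measurable (X @^-1` [set` c]) by exact:
  measurable_funPTI.
pose x m : R := dl * m%:R.
have xS m : x m.+1 = x m + dl by rewrite /x -natr1 mulrDr mulr1.
have x0 m : 0 <= x m by rewrite mulr_ge0// ltW.
(* Since [dl + h' = h], the cell [D m] is [C m] shifted by [h]. On [C m] one has [X <= x m.+1], so
   [E (X w)] lies in [E (x m.+1)]; on [D m] one has [x m.+1 <= X - h'], so [E (x m.+1)] lies in
   [E (X w - h')]. Thus one fixed event serves both cells. *)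
pose C m := X @^-1` `[x m, x m.+1[.
pose D m := X @^-1` `[x m.+1 + h', x m.+2 + h'[.
have cell m : (P (C m `&` E (x m.+1)) = (expR h)%:E * P (D m `&` E (x m.+1)))%E.
  have x1 : 0 <= x m.+1 + h' by exact: addr_ge0.
  have x2 : x m.+1 + h' <= x m.+2 + h' by rewrite [x m.+2]xS; lra.
  have x3 : x m <= x m.+1 by rewrite xS; lra.
  rewrite !EX// muleA; congr (_ * _)%E.
  rewrite !exponential_bounded// -EFinM; congr EFin.
  by rewrite mulrBr -!expRD; congr (expR _ - expR _); rewrite !xS /dl; lra.
have SC : [set w | E (X w) w] `&` X @^-1` `[0, +oo[ `<=`
    \bigcup_m (C m `&` E (x m.+1)).
  move=> w [/= Sw]; rewrite in_itv/= andbT => Xw.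
  have Xd : 0 <= X w / dl by rewrite divr_ge0// ltW.
  have /andP[lo hi] := truncn_itv Xd.
  have hi' : X w < x (Num.truncn (X w / dl)).+1.
    by rewrite /x mulrC -ltr_pdivrMr.
  exists (Num.truncn (X w / dl)) => //; split; last exact/(Emono (X w))/Sw/ltW.
  by rewrite /C/= in_itv/= hi' andbT /x mulrC -ler_pdivlMr.
have DS : \bigcup_m (D m `&` E (x m.+1)) `<=` [set w | E (X w - h') w].
  move=> w [m _ [+ Ew]]; rewrite /D/= in_itv/= => /andP[lo _].
  by apply: Emono Ew; rewrite lerBrDr.
(* Disjointness lets the probabilities of the shifted pieces add up to that of their union. *)
have tD : trivIset setT (fun m => D m `&` E (x m.+1)).
  move=> m n _ _ [w [[]]]; rewrite /D/= !in_itv/= => /andP[l1 u1] _.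
  move=> [/andP[l2 u2] _]; case: (ltngtP m n) => // mn.
    have ? : x m.+2 <= x n.+1 by rewrite ler_wpM2l ?(ltW dl0)// ler_nat.
    by exfalso; lra.
  have ? : x n.+2 <= x m.+1 by rewrite ler_wpM2l ?(ltW dl0)// ler_nat.
  by exfalso; lra.
have mCE m : measurable (C m `&` E (x m.+1)).
  by apply: measurableI => //; exact: mX.
have mDE m : measurable (D m `&` E (x m.+1)).
  by apply: measurableI => //; exact: mX.
(* The cells cover only nonnegative values of [X]; the negative ones have probability zero. *)
pose X0 := X @^-1` `[0, +oo[; pose N := X @^-1` `]-oo, 0[.
have mX0 : measurable X0 by exact: mX.
have mN : measurable N by exact: mX.
have N0 : P N = 0%E by rewrite -exponential_prob_neg -X_exp.
apply: (@le_trans _ _ (P ([set w | E (X w) w] `&` X0) + P N)%E).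
  rewrite (le_trans _ (measureU2 _ _ _))//; last exact: measurableI.
  rewrite le_measure// ?inE//; first by apply: measurableU => //;
    exact: measurableI.
  move=> w /= Sw; rewrite /X0 /N /= !in_itv/= andbT.
  by case: (leP 0 (X w)) => Xw; [left|right].
rewrite N0 adde0.
apply: (@le_trans _ _ (\sum_(m <oo) P (C m `&` E (x m.+1)))%E).
  by apply: measure_sigma_subadditive => //; exact: measurableI.
rewrite (eq_eseriesr (fun m _ => cell m)) nneseriesZl//.
rewrite lee_wpmul2l ?lee_fin ?expR_ge0//.
rewrite -measure_semi_bigcup//; last exact: bigcupT_measurable.
by rewrite le_measure// inE//; exact: bigcupT_measurable.
Qed.

(** * Stability of the leader under one more loss vector *)

(** Independence is a condition on finite subfamilies. With infinitely many competitors the product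
    rule is obtained by continuity from above along the finite intersections [F n]. *)
Lemma independent_on_bigcap (d : measure_display) (Omega : measurableType d)
    (R : realType) (P : probability Omega R) (A : pred nat)
    (q : nat -> {RV P >-> R}) (i : nat) (B0 : set R) (B : nat -> set R) :
  independent_on A q -> A i -> measurable B0 -> (forall j, measurable (B j)) ->
  (P ((q i @^-1` B0) `&` \bigcap_(j in [set j | A j && (j != i)]) (q j @^-1` B
    j))
   = P (q i @^-1` B0) *
     P (\bigcap_(j in [set j | A j && (j != i)]) (q j @^-1` B j)))%E.
Proof.
move=> q_indep Ai mB0 mB.
pose s n := [seq j <- iota 0 n | A j && (j != i)].
have mem_s n j : (j \in s n) = [&& A j, j != i & (j < n)%N].
  by rewrite mem_filter mem_iota add0n/= andbA.
pose F n := \bigcap_(j in [set` s n]) (q j @^-1` B j).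
have mq j (C : set R) : measurable C -> measurable (q j @^-1` C).
  by move=> mC; exact: measurable_funPTI.
have mF n : measurable (F n).
  by apply: bigcap_measurableType => // j _; exact: mq.
have Fcap : \bigcap_n F n =
    \bigcap_(j in [set j | A j && (j != i)]) (q j @^-1` B j).
  apply/seteqP; split => w wF j.
    move=> /andP[Aj ji]; apply: (wF j.+1) => //=.
    by rewrite mem_s Aj ji ltnSn.
  by move=> _ m /=; rewrite mem_s => /and3P[Aj ji _]; apply: wF; rewrite /= Aj.
have Fni : nonincreasing_seq F.
  move=> m n mn; apply/subsetPset => w wF j /=;
    rewrite mem_s => /and3P[Aj ji jm].
  by apply: wF; rewrite /= mem_s Aj ji (leq_trans jm).
have finite n : (P ((q i @^-1` B0) `&` F n) = P (q i @^-1` B0) * P (F n))%E.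
  (* A single family of sets, so that independence applies both to [i :: s n] and to [s n]. *)
  pose B' j := if j == i then B0 else B j.
  have mB' j : measurable (B' j) by rewrite /B'; case: ifP.
  have us : uniq (s n) by rewrite filter_uniq// iota_uniq.
  have is_ : i \notin s n by rewrite mem_s eqxx/= andbF.
  have As : {in s n, forall j, A j} by move=> j; rewrite mem_s => /and3P[].
  have B's j : j \in s n -> B' j = B j.
    by rewrite mem_s /B' => /and3P[_ /negPf ->].
  have FE : F n = \bigcap_(j in [set` s n]) (q j @^-1` B' j).
    by apply: eq_bigcapr => j /= /B's ->.
  have -> : (q i @^-1` B0) `&` F n =
      \bigcap_(j in [set` i :: s n]) (q j @^-1` B' j).
    rewrite FE; apply/seteqP; split => w /=.
      move=> [wi wF] j /=; rewrite inE => /predU1P[->|/wF//].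
      by rewrite /B' eqxx.
    move=> wF; split; last by move=> j js; apply: wF; rewrite /= inE js orbT.
    by have := wF i; rewrite /= inE eqxx/B' eqxx; exact.
  rewrite q_indep//=; last 2 first.
  - by rewrite is_.
  - by move=> j; rewrite inE => /predU1P[->//|/As].
  by rewrite big_cons {1}/B' eqxx FE q_indep.
have PF : (P (F n) @[n --> \oo] --> P (\bigcap_n F n))%E.
  apply: nonincreasing_cvg_mu => //; last exact: bigcapT_measurable.
  by rewrite ltey_eq fin_num_measure.
have PBF : (P ((q i @^-1` B0) `&` F n) @[n --> \oo] -->
    P ((q i @^-1` B0) `&` \bigcap_n F n))%E.
  rewrite -bigcapIr; last by exists 0%N.
  apply: nonincreasing_cvg_mu => //.
  - by rewrite ltey_eq fin_num_measure//; apply: measurableI => //; exact: mq.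
  - by move=> n; apply: measurableI => //; exact: mq.
  - by apply: bigcapT_measurable => n; apply: measurableI => //; exact: mq.
  - by move=> m n /Fni/subsetPset mn; apply/subsetPset; exact: setIS.
rewrite -Fcap; apply: (cvg_unique _ PBF) => //.
rewrite (_ : (fun n => _) = (fun n => P (q i @^-1` B0) * P (F n))%E).
  by apply: cvgeZl => //; rewrite fin_num_measure//; exact: mq.
by apply/funext => n; exact: finite.
Qed.

Lemma ler_scaled_score (R : realType) (e a b x y : R) : 0 < e ->
  (a + x / e <= b + y / e) = (e * a + x <= e * b + y).
Proof.
by move=> e0; rewrite -(ler_pM2l e0) !mulrDr !(mulrC e (_ / e)) !divfK ?gt_eqF.
Qed.

Lemma ltr_scaled_score (R : realType) (e a b x y : R) : 0 < e ->
  (a + x / e < b + y / e) = (e * a + x < e * b + y).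
Proof. by move=> e0; rewrite !ltNge ler_scaled_score. Qed.

(** Removes the slack [h > eta] that the discretized memorylessness argument requires. If the limit
    inequality failed, the midpoint of [x] and [ln (a / b)] would violate the hypothesis. *)
Lemma le_expR_right_limit (R : realType) (a b x : R) : 0 <= b ->
  (forall h, x < h -> a <= expR h * b) -> a <= expR x * b.
Proof.
move=> b0 H; rewrite leNgt; apply/negP => lt_a.
have b_gt0 : 0 < b.
  rewrite lt_def b0 andbT; apply/eqP => b_eq0.
  have := H (x + 1) ltac:(lra); move: lt_a; rewrite b_eq0 !mulr0; lra.
have ab0 : expR x < a / b by rewrite ltr_pdivlMr.
have ab_gt0 : 0 < a / b by exact: lt_trans (expR_gt0 x) ab0.
have xl : x < ln (a / b) by rewrite -ltr_expR lnK.
pose h := (x + ln (a / b)) / 2.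
have := H h ltac:(rewrite /h; lra).
rewrite -ler_pdivrMr// -[X in X <= _]lnK ?posrE// ler_expR /h; lra.
Qed.

(** Expert [i] leads when [q i] exceeds a threshold determined by the other perturbations, which are
    independent of [q i]. Losses in [0,1] raise this threshold by at most [eta], which costs a
    factor [expR eta] by memorylessness. *)
Lemma leader_stability (d : measure_display) (Omega : measurableType d)
    (R : realType) (P : probability Omega R) (A : pred nat)
    (q : nat -> {RV P >-> R}) (k f s : nat -> R) (eta : R) (i : nat) :
  independent_on A q ->
  (forall j, A j -> forall B : set R, measurable B ->
    distribution P (q j) B = exponential_prob 1 B) ->
  0 < eta -> (forall j, A j -> 0 <= s j <= 1) -> A i ->
  (P [set w | is_argmin A (fun j => f j + (k j - q j w) / eta)%R i] <=
   (expR eta)%:E *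
   P [set w | argmin A (fun j => (f j + s j) + (k j - q j w) / eta)%R = i])%E.
Proof.
move=> q_indep q_exp eta0 s01 Ai.
have mscore (g : nat -> R) j :
    measurable_fun setT (fun w => g j + (k j - q j w) / eta).
  exact: measurable_perturbed_score.
set S := [set w | is_argmin A _ i]; set J := [set w | argmin _ _ = i].
have mS : measurable S by apply: measurable_is_argmin; exact: mscore.
have mJ : measurable J.
  apply: (@measurable_argmin _ _ _ _ (fun w j => f j + s j + (k j - q j w) /
    eta)) => j.
  exact: (mscore (fun j => f j + s j)).
have -> : P S = (fine (P S))%:E by rewrite fineK// fin_num_measure.
have -> : P J = (fine (P J))%:E by rewrite fineK// fin_num_measure.
rewrite -EFinM lee_fin; apply: le_expR_right_limit => [|h eta_h].
  by rewrite fine_ge0.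
rewrite -lee_fin EFinM !fineK ?fin_num_measure//.
(* After multiplication by [eta], the score of [i] is at most that of [j] exactly when
   [q j + c j <= q i]. *)
pose c j := eta * (f i - f j) + (k i - k j).
pose E x := \bigcap_(j in [set j | A j && (j != i)]) (q j @^-1` `]-oo, x - c
  j]).
(* Strictly between [eta] and [h]: being above [eta] excludes ties after the losses are added, being
   below [h] gives cells of positive width. *)
pose h' := (eta + h) / 2.
have EP x w : E x w <-> (forall j, A j -> j != i -> q j w + c j <= x).
  split=> [Ex j Aj ji|qx j /andP[Aj ji]].
    by have := Ex j; rewrite /= Aj ji in_itv/= lerBrDr; exact.
  by rewrite /= in_itv/= lerBrDr qx.
have SE : S = [set w | E (q i w) w].
  apply/seteqP; split => w; rewrite /S /=.
    move=> [_ qi]; apply/EP => j Aj ji; have := qi j Aj.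
    rewrite /= !ler_scaled_score//.
    by rewrite /c; lra.
  move=> /EP qi; split => // j Aj; have [->//|ji] := eqVneq j i.
  have := qi j Aj ji.
  rewrite /= !ler_scaled_score//.
  by rewrite /c; lra.
have EJ : [set w | E (q i w - h') w] `<=` J.
  move=> w /= /EP qi; apply: argmin_strict => // j Aj ji; have := qi j Aj ji.
  rewrite ltr_scaled_score//.
  have /andP[_ si] := s01 i Ai; have /andP[sj _] := s01 j Aj.
  have : eta * s i <= eta by rewrite ler_piMr// ltW.
  have : 0 <= eta * s j by rewrite mulr_ge0// ltW.
  by rewrite /c /h'; lra.
have mE x : measurable (E x).
  by apply: bigcap_measurableType => // j _; exact: measurable_funPTI.
have mEh : measurable [set w | E (q i w - h') w].
  rewrite (_ : mkset _ = \bigcap_(j in [set j | A j && (j != i)])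
      [set w | q j w + c j <= q i w - h']).
    apply: bigcap_measurableType => j _; rewrite -[X in measurable X]setTI.
    have := @measurable_fun_ler _ _ _ setT (fun w => q j w + c j)
      (fun w => q i w - h').
    move=> /(_ _ _ measurableT [set true]); apply => //.
      exact: measurable_funD.
    exact: measurable_funB.
  apply/seteqP; split => w /=; first by move=> /EP qi j /= /andP[]; exact: qi.
  by move=> qi; apply/EP => j Aj ji; apply: qi; rewrite /= Aj.
have : (P [set w | E (q i w) w] <=
    (expR h)%:E * P [set w | E (q i w - h')%R w])%E.
  apply: exponential_memoryless => //; rewrite -?SE//.
  - exact: q_exp.
  - by move=> x y xy w /EP qx; apply/EP => j Aj ji; apply: le_trans xy;
    exact: qx.
  - by move=> B x mB; apply: independent_on_bigcap.
  - by rewrite /h'; lra.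
  - by rewrite /h'; lra.
rewrite -SE => /le_trans; apply; rewrite lee_wpmul2l ?lee_fin ?expR_ge0//.
by rewrite le_measure// inE.
Qed.

Lemma measurable_comp_nat (d : measure_display) (T : measurableType d)
    (R : realType) (N : T -> nat) (g : nat -> R) :
  (forall i, measurable [set w | N w = i]) ->
  measurable_fun setT (fun w => g (N w)).
Proof.
move=> mN _ B mB; rewrite setTI.
rewrite (_ : _ @^-1` _ = \bigcup_(i in [set i | B (g i)]) [set w | N w = i]).
  exact: bigcup_measurable.
by apply/seteqP; split => [w Bw|w [i /= Bi Nw]]; [exists (N w)|rewrite /= Nw].
Qed.

Lemma integral_comp_nat (d : measure_display) (T : measurableType d)
    (R : realType) (mu : {measure set T -> \bar R}) (N : T -> nat)
    (g : nat -> R) :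
  (forall i, measurable [set w | N w = i]) -> (forall i, 0 <= g i) ->
  (\int[mu]_w (g (N w))%:E =
   \sum_(i <oo) (g i)%:E * mu [set w | N w = i])%E.
Proof.
move=> mN g0.
have TE : [set: T] = \bigcup_i [set w | N w = i].
  by apply/seteqP; split => // w _; exists (N w).
rewrite TE ge0_integral_bigcup//; last 3 first.
- by rewrite -TE; apply/measurable_EFinP; exact: measurable_comp_nat.
- by move=> w _; rewrite lee_fin.
- by move=> i j _ _ [w [/= <- <-]].
apply: eq_eseriesr => i _; rewrite -integral_cst//.
by apply: eq_integral => w; rewrite inE /= => ->.
Qed.

(** The expected loss is the sum over experts of loss times selection probability, so
    [leader_stability] applies term by term. The vector [s] is both the loss incurred and the loss
    that the lookahead scores include. *)
Lemma expected_loss_stability (d : measure_display) (Omega : measurableType d)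
    (R : realType) (P : probability Omega R) (A : pred nat)
    (q : nat -> {RV P >-> R}) (k f s : nat -> R) (eta : R) :
  independent_on A q ->
  (forall j, A j -> forall B : set R, measurable B ->
    distribution P (q j) B = exponential_prob 1 B) ->
  0 < eta -> (forall j, A j -> 0 <= s j <= 1) -> A 0%N ->
  (P [set w | ~ exists i, is_argmin A (fun j => f j + (k j - q j w) / eta)%R i]
   = 0)%E ->
  (\int[P]_w (s (argmin A (fun j => f j + (k j - q j w) / eta)%R))%:E <=
   (expR eta)%:E * \int[P]_w
     (s (argmin A (fun j => (f j + s j) + (k j - q j w) / eta)%R))%:E)%E.
Proof.
move=> q_indep q_exp eta0 s01 A0 attained.
have mscore (g : nat -> R) j :
    measurable_fun setT (fun w => g j + (k j - q j w) / eta).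
  exact: measurable_perturbed_score.
(* Junk losses outside [A] may be negative; setting them to 0 changes nothing, as [argmin] stays in
   [A]. *)
pose g j := if A j then s j else 0.
have g0 j : 0 <= g j by rewrite /g; case: ifP => // /s01 /andP[].
have gE (F : Omega -> nat -> R) : (\int[P]_w (s (argmin A (F w)))%:E =
    \int[P]_w (g (argmin A (F w)))%:E)%E.
  by apply: eq_integral => w _; rewrite /g argmin_in.
have mI i : measurable [set w | argmin A (fun j => f j + (k j - q j w) / eta) =
  i].
  apply: (@measurable_argmin _ _ _ _ (fun w j => f j + (k j - q j w) / eta)) =>
    j.
  exact: (mscore f).
have mJ i : measurable
    [set w | argmin A (fun j => f j + s j + (k j - q j w) / eta) = i].
  apply: (@measurable_argmin _ _ _ _ (fun w j => f j + s j + (k j - q j w) /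
    eta)) => j.
  exact: (mscore (fun j => f j + s j)).
rewrite !gE !integral_comp_nat// -nneseriesZl; last first.
  by move=> i _; rewrite mule_ge0// lee_fin.
apply: lee_nneseries => i _; first by rewrite mule_ge0// lee_fin.
have [Ai|nAi] := boolP (A i); last by rewrite /g (negPf nAi) !mul0e mule0.
rewrite muleCA lee_wpmul2l ?lee_fin//.
apply: le_trans (leader_stability k f q_indep q_exp eta0 s01 Ai).
(* Selecting [i] means that [i] is a minimizer, except on the null set [Z], where [argmin] takes its
   default value. *)
set Z := [set w | ~ _] in attained.
set S := [set w | is_argmin A _ i].
have mS : measurable S by apply: measurable_is_argmin; exact: mscore.
have mZ : measurable Z by apply: measurable_no_argmin; exact: mscore.
rewrite -[X in (_ <= X)%E]adde0 -attained.
rewrite (le_trans _ (measureU2 _ _ _))// le_measure// ?inE//.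
  exact: measurableU.
move=> w /= wi; have [ex|nex] := pselect (exists i, is_argmin A
  (fun j => f j + (k j - q j w) / eta) i); last by right.
by left; rewrite /S /= -wi; exact: is_argmin_argmin.
Qed.

(** * Almost sure existence of a leader and expected lookahead regret *)

(* The Kraft inequality makes [P (q j >= k j - c)] summable, so by
   Borel-Cantelli almost surely [k j - q j] tends to infinity along the
   experts. *)
Lemma leader_exists_ae (d : measure_display) (Omega : measurableType d)
    (R : realType) (P : probability Omega R) (A : pred nat)
    (q : nat -> {RV P >-> R}) (k f : nat -> R) (eta : R) :
  (\sum_(0 <= i <oo | A i) (expR (- k i))%:E <= 1)%E ->
  (forall j, A j -> forall B : set R, measurable B ->
    distribution P (q j) B = exponential_prob 1 B) ->
  0 < eta -> (forall j, A j -> 0 <= f j) -> A 0%N ->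
  (P [set w | ~ exists i, is_argmin A (fun j => f j + (k j - q j w) / eta)%R i]
   = 0)%E.
Proof.
move=> kraft q_exp eta0 f0 A0.
pose F (c : nat) j : set Omega :=
  if A j then q j @^-1` `[k j - c%:R, +oo[ else set0.
have mF c j : measurable (F c j).
  by rewrite /F; case: ifP => // _; exact: measurable_funPTI.
have PF c j : A j -> (P (F c j) <= (expR c%:R)%:E * (expR (- k j))%:E)%E.
  move=> Aj; rewrite -EFinM -expRD /F Aj.
  have [kc|kc] := leP 0 (k j - c%:R).
    by rewrite exponential_ge//; [rewrite opprB|exact: q_exp].
  (* Here [k j < c], so the claimed bound is at least 1. *)
  rewrite (le_trans (probability_le1 _ _))//; first exact: measurable_funPTI.
  by rewrite lee_fin -[leLHS]expR0 ler_expR; lra.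
have limF c : P (lim_sup_set (F c)) = 0%E.
  apply: lim_sup_set_cvg0 => //.
  apply: (@le_lt_trans _ _ ((expR c%:R)%:E *
      \sum_(0 <= j <oo | A j) (expR (- k j))%:E)%E).
    rewrite -nneseriesZl; last by move=> j _; rewrite lee_fin expR_ge0.
    rewrite [leRHS]eseries_mkcond; apply: lee_nneseries => // j _.
    by case: ifPn => [Aj|nAj]; [exact: PF|rewrite /F (negPf nAj) measure0].
  apply: (@le_lt_trans _ _ ((expR c%:R)%:E * 1)%E); last by rewrite mule1 ltry.
  by rewrite lee_wpmul2l// lee_fin expR_ge0.
set Z := mkset _.
have mZ : measurable Z.
  by apply: measurable_no_argmin => j; exact: measurable_perturbed_score.
apply/eqP; rewrite eq_le measure_ge0 andbT.
have : (P Z <= \sum_(c <oo) P (lim_sup_set (F c)))%E.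
  apply: measure_sigma_subadditive => //.
    move=> c; apply: bigcapT_measurable => m.
    by apply: bigcup_measurable => j _; exact: mF.
  move=> w; apply: contraPP => nw; apply.
  (* The rescaled score of expert 0. For [c > b], all but finitely many [j] satisfy
     [k j - q j w > c], and as [f j >= 0] they score worse than expert 0; a minimum over finitely
     many experts remains. *)
  pose b := eta * f 0%N + (k 0%N - q 0%N w).
  have [c bc] : exists c : nat, b < c%:R.
    exists (Num.truncn `|b|).+1; apply: le_lt_trans (ler_norm b) _.
    exact: truncnS_gt.
  have [N FN] : exists N, forall j, (N <= j)%N -> ~ F c j w.
    have : ~ lim_sup_set (F c) w by move=> wc; apply: nw; exists c.
    move=> /existsNP[N /not_implyP[_ wN]]; exists N => j Nj wj.
    by apply: wN; exists j.
  apply: (is_argmin_exists (i := 0%N) (N := N)) => // j Nj Aj.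
  rewrite ler_scaled_score// -/b.
  have := FN j Nj; rewrite /F Aj /= in_itv/= andbT => /negP.
  have : 0 <= eta * f j by apply: mulr_ge0; [exact: ltW|exact: f0].
  by rewrite -ltNge; lra.
by rewrite eseries0// => c _ _; exact: limF.
Qed.

(** The sum of the positive parts stands in for their maximum: it still bounds every [q j - k j],
    and by Tonelli its expectation is the Kraft sum. *)
Lemma expected_max_perturbation (d : measure_display) (Omega : measurableType d)
    (R : realType) (P : probability Omega R) (A : pred nat)
    (q : nat -> {RV P >-> R}) (k : nat -> R) :
  (forall j, A j -> 0 <= k j) ->
  (\sum_(0 <= i <oo | A i) (expR (- k i))%:E <= 1)%E ->
  (forall j, A j -> forall B : set R, measurable B ->
    distribution P (q j) B = exponential_prob 1 B) ->
  (\int[P]_w (\sum_(0 <= j <oo | A j) (Num.max (q j w - k j)%R 0%R)%:E) <= 1)%E.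
Proof.
move=> k0 kraft q_exp.
under eq_integral do rewrite eseries_mkcond.
rewrite integral_nneseries//; last 2 first.
- move=> j; case: (A j) => //; apply/measurable_EFinP.
  by apply: measurable_maxr => //; exact: measurable_funB.
- by move=> j w _; case: (A j) => //; rewrite lee_fin le_max lexx orbT.
rewrite (le_trans _ kraft)// [leRHS]eseries_mkcond; apply: lee_nneseries.
  move=> j _ _; apply: integral_ge0 => w _.
  by case: (A j) => //; rewrite lee_fin le_max lexx orbT.
move=> j _; case: ifPn => [Aj|]; last by rewrite integral0.
by rewrite (expectation_pospart_exponential (k0 j Aj) (q_exp j Aj)).
Qed.

(** The pathwise regret bound is integrated with [q i] kept on the left, so that both integrands are
    nonnegative. The two perturbation terms then contribute [1 / eta T] on the left and at most
    [1 / eta T] on the right. *)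
Lemma lookahead_expected_regret (d : measure_display)
    (Omega : measurableType d) (R : realType) (P : probability Omega R)
    (A : pred nat) (q : nat -> {RV P >-> R}) (k : nat -> R)
    (s : nat -> nat -> R) (eta : nat -> R) (T i : nat) :
  (forall j, A j -> 0 <= k j) ->
  (\sum_(0 <= j <oo | A j) (expR (- k j))%:E <= 1)%E ->
  (forall j, A j -> forall B : set R, measurable B ->
    distribution P (q j) B = exponential_prob 1 B) ->
  (1 <= T)%N ->
  (forall t j, (1 <= t <= T)%N -> A j -> 0 <= s t j <= 1) ->
  (forall t, (1 <= t <= T)%N -> 0 < eta t) ->
  (forall t, (1 <= t < T)%N -> eta t.+1 <= eta t) ->
  A 0%N -> A i ->
  (\sum_(1 <= t < T.+1) \int[P]_w (s t (argmin A (fun j =>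
     \sum_(1 <= u < t.+1) s u j + (k j - q j w) / eta t)%R))%:E <=
   (\sum_(1 <= t < T.+1) s t i + k i / eta T)%:E)%E.
Proof.
move=> k0 kraft q_exp T1 s01 eta0 etam A0 Ai.
have TT : (1 <= T <= T)%N by rewrite T1 leqnn.
have e0 : 0 <= (eta T)^-1 by rewrite invr_ge0 ltW// eta0.
pose sc t w j := \sum_(1 <= u < t.+1) s u j + (k j - q j w) / eta t.
have msc t j : measurable_fun setT (sc t ^~ j).
  exact: measurable_perturbed_score.
have sum_s t j : (t <= T)%N -> A j -> 0 <= \sum_(1 <= u < t.+1) s u j.
  move=> tT Aj; rewrite big_nat sumr_ge0// => u /andP[u1 ut].
  by have /andP[] : 0 <= s u j <= 1 by apply: s01;
    rewrite // u1 (leq_trans _ tT).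
pose g t j := if (1 <= t <= T)%N && A j then s t j else 0.
have g0 t j : 0 <= g t j.
  by rewrite /g; case: ifP => // /andP[tT Aj]; have /andP[] := s01 t j tT Aj.
have mg t : measurable_fun setT (fun w => (g t (argmin A (sc t w)))%:E).
  apply/measurable_EFinP; apply: measurable_comp_nat => j.
  exact: measurable_argmin.
have gE t w : (1 <= t < T.+1)%N -> s t (argmin A (sc t w)) = g t (argmin A (sc
  t w)).
  by rewrite ltnS => tT; rewrite /g tT argmin_in.
pose Q w := (\sum_(0 <= j <oo | A j) (Num.max (q j w - k j)%R 0%R)%:E)%E.
have m0 j w : (0 <= (Num.max (q j w - k j) 0)%:E)%E by rewrite lee_fin le_max
  lexx orbT.
have Q0 w : (0 <= Q w)%E by exact: nneseries_ge0.
have mQ : measurable_fun setT Q.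
  have := @ge0_emeasurable_sum _ _ R setT
    (fun j w => (Num.max (q j w - k j) 0)%:E) A.
  apply => // j _; apply/measurable_EFinP.
  by apply: measurable_maxr => //; exact: measurable_funB.
pose C := \sum_(1 <= t < T.+1) s t i + k i / eta T.
have C0 : 0 <= C by rewrite addr_ge0 ?sum_s// mulr_ge0// k0.
(* The positive part of [q i w - 0] equals [q i w] almost surely, and in this form
   [expectation_pospart_exponential] applies with [k = 0]. *)
pose lhs w := (\sum_(1 <= t < T.+1) (g t (argmin A (sc t w)))%:E +
  (eta T)^-1%:E * (Num.max (q i w - 0)%R 0%R)%:E)%E.
pose rhs w := (C%:E + (eta T)^-1%:E * Q w)%E.
have mqi : measurable_fun setT (fun w => (Num.max (q i w - 0) 0)%:E).
  apply/measurable_EFinP.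
  by apply: measurable_maxr => //; exact: measurable_funB.
have qi0 w : (0 <= (Num.max (q i w - 0) 0)%:E)%E.
  by rewrite lee_fin le_max lexx orbT.
have sumg0 w : (0 <= \sum_(1 <= t < T.+1) (g t (argmin A (sc t w)))%:E)%E.
  by apply: sume_ge0 => t _; rewrite lee_fin.
have msumg : measurable_fun setT
    (fun w => \sum_(1 <= t < T.+1) (g t (argmin A (sc t w)))%:E)%E.
  exact: emeasurable_sum.
have ae_attained : {ae P, forall w, forall t, (1 <= t <= T)%N ->
    exists j, is_argmin A (sc t w) j}.
  apply: ae_foralln => t; have [tT|ntT] := boolP (1 <= t <= T)%N; last first.
    by apply: aeW => w.
  exists [set w | ~ exists j, is_argmin A (sc t w) j]; split.
  - exact: measurable_no_argmin.
  - apply: leader_exists_ae => //; first exact: eta0.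
    by move=> j Aj; apply: sum_s => //; case/andP: tT.
  - by move=> w; apply: contra_not => ex _.
have ae_qi : {ae P, forall w, 0 <= q i w}.
  exists (q i @^-1` `]-oo, 0[); split.
  - exact: measurable_funPTI.
  - by rewrite -exponential_prob_neg -(q_exp i Ai).
  - by move=> w /=; rewrite in_itv/= ltNge => /negP.
have lhs_rhs : {ae P, forall w, setT w -> (lhs w <= rhs w)%E}.
  move: ae_attained ae_qi; apply: filterS2 => w att qw _.
  (* Where the series [Q w] diverges the right side is infinite; elsewhere the inequality is one
     between reals. *)
  rewrite /lhs /rhs; have [QE|QE] := eqVneq (Q w) +oo%E.
    rewrite QE gt0_muley ?lte_fin ?invr_gt0 ?eta0//.
    by rewrite addey// leey.
  have Qfin : Q w \is a fin_num by rewrite ge0_fin_numE// ltey.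
  rewrite -(fineK Qfin) -!EFinM sumEFin -!EFinD lee_fin.
  have -> : Num.max (q i w - 0) 0 = q i w by rewrite subr0; apply/max_idPl.
  have -> : \sum_(1 <= t < T.+1) g t (argmin A (sc t w)) =
      \sum_(1 <= t < T.+1) s t (argmin A (sc t w)).
    by apply: eq_big_nat => t tT; rewrite gE.
  rewrite [_^-1 * q i w]mulrC [_^-1 * fine _]mulrC.
  rewrite /C -addrA -mulrDl.
  apply: (@lookahead_leader_regret _ A k (fun j => q j w) s eta
    (fun t => argmin A (sc t w)) (fine (Q w)) T) => //.
  - by rewrite fine_ge0.
  - move=> j Aj; rewrite -lee_fin fineK//.
    apply: (@le_trans _ _ (Num.max (q j w - k j) 0)%:E).
      by rewrite lee_fin le_max lexx.
    rewrite /Q (nneseriesD1 (n := j))//.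
    by rewrite leeDl// nneseries_ge0.
  - by move=> t tT; apply: is_argmin_argmin; exact: att.
have meq : measurable_fun setT
    (fun w => (eta T)^-1%:E * (Num.max (q i w - 0)%R 0%R)%:E)%E.
  exact: measurable_funeM.
have meQ : measurable_fun setT (fun w => (eta T)^-1%:E * Q w)%E.
  exact: measurable_funeM.
have lhs0 w : setT w -> (0 <= lhs w)%E.
  by move=> _; rewrite adde_ge0// mule_ge0.
have rhs0 w : setT w -> (0 <= rhs w)%E.
  by move=> _; rewrite adde_ge0// ?lee_fin// mule_ge0.
have mlhs : measurable_fun setT lhs by exact: emeasurable_funD.
have mrhs : measurable_fun setT rhs by exact: emeasurable_funD.
have := ae_ge0_le_integral measurableT lhs0 mlhs rhs0 mrhs lhs_rhs.
rewrite /lhs /rhs ge0_integralD//; last by move=> w _; rewrite mule_ge0.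
rewrite ge0_integralD//; last by move=> w _; rewrite mule_ge0.
rewrite !ge0_integralZl// ge0_integral_sum//; last first.
  by move=> t w _; rewrite lee_fin.
rewrite (expectation_pospart_exponential (lexx 0) (q_exp i Ai)) oppr0 expR0
  mule1.
have := expectation_cst P C; rewrite unlock => -> H.
have : (\sum_(1 <= t < T.+1) \int[P]_w (g t (argmin A (sc t w)))%:E +
   (eta T)^-1%:E <= C%:E + (eta T)^-1%:E)%E.
  apply: le_trans H _; rewrite leeD2l//.
  rewrite -[leRHS]mule1 lee_wpmul2l// ?lee_fin//.
  exact: expected_max_perturbation.
rewrite leeD2rE//; apply: le_trans; rewrite big_nat [leRHS]big_nat.
apply: lee_sum => t tT; rewrite le_eqVlt; apply/orP; left; apply/eqP.
by apply: eq_integral => w _; rewrite -gE.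
Qed.

(** * Regret of FPL and the self-confident learning rates *)

Lemma fpl_expected_loss_itv (R : realType) (d : measure_display)
    (Omega : measurableType d) (P : probability Omega R) (n : option nat)
    (k : nat -> R) (q : nat -> {RV P >-> R}) (s : nat -> nat -> R)
    (eta x : R) (t : nat) :
  experts n 0%N -> (forall j, experts n j -> 0 <= s t j <= 1) ->
  x%:E = fpl_expected_loss q n k s eta t -> 0 <= x <= 1.
Proof.
move=> A0 s01; rewrite /fpl_expected_loss unlock => xE.
pose I w := fpl_choice n k s eta t (fun j => q j w).
have sI w : 0 <= s t (I w) <= 1 by exact/s01/argmin_in.
have mI : measurable_fun setT (fun w => (s t (I w))%:E).
  apply/measurable_EFinP; apply: measurable_comp_nat => i.
  by apply: measurable_argmin => j; exact: measurable_perturbed_score.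
rewrite -!lee_fin xE; apply/andP; split.
  by apply: integral_ge0 => w _; rewrite lee_fin; case/andP: (sI w).
have := expectation_cst P 1; rewrite unlock => <-.
apply: ge0_le_integral => //.
- by move=> w _; rewrite lee_fin; case/andP: (sI w).
- exact/measurable_EFinP.
- by move=> w _; rewrite lee_fin; case/andP: (sI w).
Qed.

Lemma fpl_regret (R : realType) (d : measure_display)
    (Omega : measurableType d) (P : probability Omega R)
    (n : option nat) (k : nat -> R) (q : nat -> {RV P >-> R})
    (T : nat) (s : nat -> nat -> R) (eta ell : nat -> R) (i : nat) :
  (forall j, experts n j -> 0 <= k j) ->
  (\sum_(0 <= j <oo | experts n j) (expR (- k j))%:E <= 1)%E ->
  independent_on (experts n) q ->
  (forall j, experts n j -> forall B : set R, measurable B ->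
    distribution P (q j) B = exponential_prob 1 B) ->
  (1 <= T)%N ->
  (forall t j, (1 <= t <= T)%N -> experts n j -> 0 <= s t j <= 1) ->
  (forall t, (1 <= t <= T)%N -> 0 < eta t) ->
  (forall t, (1 <= t < T)%N -> eta t.+1 <= eta t) ->
  (forall t, (1 <= t <= T)%N ->
    (ell t)%:E = fpl_expected_loss q n k s (eta t) t) ->
  experts n i ->
  \sum_(1 <= t < T.+1) ell t <= \sum_(1 <= t < T.+1) s t i + k i / eta T
    + \sum_(1 <= t < T.+1) eta t * ell t.
Proof.
move=> k0 kraft q_indep q_exp T1 s01 eta0 etam ellE Ai.
(* As expert [i] exists, so does expert 0, and the default value of [argmin] is a genuine expert. *)
have A0 : experts n 0%N by case: (n) Ai => // m; exact: leq_ltn_trans.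
set A := experts n in k0 kraft q_indep q_exp s01 Ai A0 *.
pose sc t w j := \sum_(1 <= u < t.+1) s u j + (k j - q j w) / eta t.
pose r t := (\int[P]_w (s t (argmin A (sc t w)))%:E)%E.
have s0 t j : (1 <= t <= T)%N -> A j -> 0 <= s t j.
  by move=> tT Aj; have /andP[] := s01 t j tT Aj.
have r0 t : (1 <= t <= T)%N -> (0 <= r t)%E.
  by move=> tT; apply: integral_ge0 => w _; rewrite lee_fin s0// argmin_in.
have ell0 t : (1 <= t <= T)%N -> 0 <= ell t.
  move=> tT; have s01t j := s01 t j tT.
  by have /andP[] := fpl_expected_loss_itv A0 s01t (ellE t tT).
have ell_r t : (1 <= t <= T)%N -> ((ell t)%:E <= (expR (eta t))%:E * r t)%E.
  move=> tT; rewrite ellE// /fpl_expected_loss unlock.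
  have rE : r t = (\int[P]_w (s t (argmin A (fun j =>
      (\sum_(1 <= u < t) s u j + s t j) + (k j - q j w) / eta t)%R))%:E)%E.
    apply: eq_integral => w _; congr (s t (argmin A _))%:E; apply/funext => j.
    by rewrite /sc big_nat_recr//; case/andP: tT.
  have f0 j : A j -> 0 <= \sum_(1 <= u < t) s u j.
    move=> Aj; rewrite big_nat sumr_ge0// => u /andP[u1 ut]; apply: s0 => //.
    by rewrite u1 ltnW// (leq_trans ut)//; case/andP: tT.
  rewrite rE; apply: expected_loss_stability => //.
  - exact: eta0.
  - by move=> j; exact: s01.
  - by apply: leader_exists_ae => //; exact: eta0.
have r_sum : (\sum_(1 <= t < T.+1) r t <=
    (\sum_(1 <= t < T.+1) s t i + k i / eta T)%:E)%E.
  exact: lookahead_expected_regret.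
have ell_le t : (1 <= t < T.+1)%N -> ((ell t - eta t * ell t)%R%:E <= r t)%E.
  rewrite ltnS => tT; have := r0 t tT; have := ell_r t tT.
  case: (r t) => [x| |]; [|by move=> _ _; rewrite leey|by move=> _;
    rewrite leNgt ltNyr].
  rewrite -EFinM !lee_fin => ex x0.
  (* Stability gives $e^{-\eta_t}\ell_t\le r_t$, and $e^{-\eta_t}\ge1-\eta_t$. *)
  have eN : expR (- eta t) * expR (eta t) = 1 by rewrite -expRD addNr expR0.
  have := ler_wpM2l (expR_ge0 (- eta t)) ex; rewrite mulrA eN mul1r.
  have := ler_wpM2r (ell0 t tT) (expR_ge1Dx (- eta t)); lra.
have : ((\sum_(1 <= t < T.+1) (ell t - eta t * ell t)%R)%:E <=
    (\sum_(1 <= t < T.+1) s t i + k i / eta T)%:E)%E.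
  apply: le_trans r_sum; rewrite -sumEFin big_nat [leRHS]big_nat.
  by apply: lee_sum => t; exact: ell_le.
rewrite lee_fin sumrB; lra.
Qed.

(** Common form of both claims. The complexity term is at most [k i / a] and the stability term at
    most [a] times the same square root of the total loss, so [c] bounds their joint coefficient and
    [le_selfbounded] finishes. *)
Lemma fpl_selfconfident (R : realType) (d : measure_display)
    (Omega : measurableType d) (P : probability Omega R)
    (n : option nat) (k : nat -> R) (q : nat -> {RV P >-> R})
    (T : nat) (s : nat -> nat -> R) (eta ell : nat -> R) (i : nat) (a c : R) :
  (forall j, experts n j -> 0 <= k j) ->
  (\sum_(0 <= j <oo | experts n j) (expR (- k j))%:E <= 1)%E ->
  independent_on (experts n) q ->
  (forall j, experts n j -> forall B : set R, measurable B ->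
    distribution P (q j) B = exponential_prob 1 B) ->
  (1 <= T)%N ->
  (forall t j, (1 <= t <= T)%N -> experts n j -> 0 <= s t j <= 1) ->
  (forall t, (1 <= t <= T)%N ->
    (ell t)%:E = fpl_expected_loss q n k s (eta t) t) ->
  0 < a ->
  (forall t, (1 <= t <= T)%N ->
    eta t = a / Num.sqrt (2 * (\sum_(1 <= u < t) ell u + 1))) ->
  experts n i -> k i / a + a <= c ->
  \sum_(1 <= t < T.+1) ell t <= \sum_(1 <= t < T.+1) s t i
    + c * Num.sqrt (2 * (\sum_(1 <= t < T.+1) s t i + 1)) + 2 * c ^+ 2.
Proof.
move=> k0 kraft q_indep q_exp T1 s01 ellE a0 etaE Ai kac.
have ell01 t : (1 <= t <= T)%N -> 0 <= ell t <= 1.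
  move=> tT; apply: fpl_expected_loss_itv (ellE t tT) => [|j]; last exact: s01.
  by case: (n) Ai => // m; exact: leq_ltn_trans.
pose L t := \sum_(1 <= u < t) ell u.
have LS t : (1 <= t)%N -> L t.+1 = L t + ell t by move=> t1;
  exact: big_nat_recr.
have L0 t : (t <= T.+1)%N -> 0 <= L t.
  move=> tT; rewrite /L big_nat sumr_ge0// => u /andP[u1 ut].
  by have /andP[] : 0 <= ell u <= 1 by apply: ell01;
    rewrite u1 -ltnS (leq_trans ut).
have L_le t : (1 <= t <= T)%N -> L t <= L t.+1.
  by move=> /[dup] tT /andP[t1 _]; rewrite LS// lerDl; case/andP: (ell01 t tT).
have sq_gt0 t : (t <= T.+1)%N -> 0 < Num.sqrt (2 * (L t + 1)).
  by move=> /L0 ?; rewrite sqrtr_gt0; lra.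
have TT : (1 <= T <= T)%N by rewrite T1 leqnn.
have etaL t : (1 <= t <= T)%N -> eta t = a / Num.sqrt (2 * (L t + 1)).
  exact: etaE.
have eta0 t : (1 <= t <= T)%N -> 0 < eta t.
  by move=> tT; rewrite etaL// divr_gt0// sq_gt0//; case/andP: tT => _ /leqW.
have etam t : (1 <= t < T)%N -> eta t.+1 <= eta t.
  move=> /andP[t1 tT]; have tT' : (1 <= t <= T)%N by rewrite t1 ltnW.
  have tT1 : (t <= T.+1)%N by rewrite leqW// ltnW.
  rewrite (etaL t.+1)// (etaL t)// ler_pM2l// lef_pV2 ?posrE ?sq_gt0//;
    last exact: leqW.
  by rewrite ler_sqrt; have := L_le t tT'; have := L0 t tT1; lra.
have := fpl_regret k0 kraft q_indep q_exp T1 s01 eta0 etam ellE Ai.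
have -> : \sum_(1 <= t < T.+1) eta t * ell t = a *
    \sum_(1 <= t < T.+1) ell t / Num.sqrt (2 * (L t + 1)).
  rewrite mulr_sumr; apply: eq_big_nat => t; rewrite ltnS => tT.
  by rewrite etaL// -mulrA [_^-1 * _]mulrC.
have := sum_selfconfident ell01; rewrite -/(L T.+1).
set Z := \sum_(1 <= t < T.+1) _ / _ => ZL.
(* The last rate depends on the losses before [T] only; [L T <= L T.+1] passes to the total loss. *)
have kT : k i / eta T <= k i / a * Num.sqrt (2 * (L T.+1 + 1)).
  rewrite etaL// invf_div -mulrA [a^-1 * _]mulrC; apply: ler_wpM2l;
    first exact: k0.
  rewrite ler_pM2r ?invr_gt0// ler_sqrt.
    by have := L_le T TT; lra.
  by have := L0 T.+1 (leqnn _); lra.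
have aZ : a * Z <= a * Num.sqrt (2 * (L T.+1 + 1)).
  rewrite ler_pM2l//; apply: le_trans ZL _; rewrite ler_sqrt; first lra.
  by have := L0 T.+1 (leqnn _); lra.
move=> reg; set S := \sum_(1 <= t < T.+1) s t i in reg *.
have S0 : 0 <= S.
  rewrite /S big_nat sumr_ge0// => t; rewrite ltnS => tT.
  by case/andP: (s01 t i tT Ai).
have c0 : 0 <= c.
  by apply: le_trans kac; rewrite addr_ge0 ?divr_ge0 ?k0// ltW.
have := ler_wpM2r (ltW (sq_gt0 T.+1 (leqnn _))) kac; rewrite mulrDl => kac'.
have LT0 := L0 T.+1 (leqnn _).
(* Adding 1 on both sides makes the quantity under the root equal to the one being bounded. *)
have : L T.+1 + 1 <= S + 1 + c * Num.sqrt (2 * (L T.+1 + 1)) by lra.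
move=> /le_selfbounded; rewrite !addr_ge0// => /(_ c0 isT isT); lra.
Qed.

Theorem theorem7 (R : realType) (d : measure_display)
    (Omega : measurableType d) (P : probability Omega R)
    (n : option nat) (k : nat -> R) (q : nat -> {RV P >-> R})
    (T : nat) (s : nat -> nat -> R) (eta ell : nat -> R)
    (k_ge0 : forall i, experts n i -> 0 <= k i)
    (kraft : (\sum_(0 <= i <oo | experts n i) (expR (- k i))%:E <= 1)%E)
    (q_indep : independent_on (experts n) q)
    (q_exp : forall i, experts n i -> forall A : set R, measurable A ->
       distribution P (q i) A = exponential_prob 1 A)
    (T_ge1 : (1 <= T)%N)
    (s01 : forall t i, (1 <= t <= T)%N -> experts n i -> 0 <= s t i <= 1)
    (eta_gt0 : forall t, (1 <= t <= T)%N -> 0 < eta t)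
    (ellE : forall t, (1 <= t <= T)%N ->
       (ell t)%:E = fpl_expected_loss q n k s (eta t) t) :
  ((forall t, (1 <= t <= T)%N ->
      eta t = 1 / Num.sqrt (2 * (\sum_(1 <= u < t) ell u + 1))) ->
   forall i, experts n i ->
     \sum_(1 <= t < T.+1) ell t <=
       \sum_(1 <= t < T.+1) s t i
       + (k i + 1) * Num.sqrt (2 * (\sum_(1 <= t < T.+1) s t i + 1))
       + 2 * (k i + 1) ^+ 2)
  /\
  (forall K : R, 0 < K -> (forall i, experts n i -> k i <= K) ->
   (forall t, (1 <= t <= T)%N ->
      eta t = Num.sqrt (K / (2 * (\sum_(1 <= u < t) ell u + 1)))) ->
   forall i, experts n i ->
     \sum_(1 <= t < T.+1) ell t <=
       \sum_(1 <= t < T.+1) s t i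
       + 2 * Num.sqrt (2 * (\sum_(1 <= t < T.+1) s t i + 1) * K)
       + 8 * K).
Proof.
split=> [etaE|K K0 kK etaE] i Ai.
  (* Here [a = 1] and [c = k i + 1]. *)
  have := fpl_selfconfident k_ge0 kraft q_indep q_exp T_ge1 s01 ellE ltr01 etaE
    Ai.
  by apply; rewrite divr1.
have sK : 0 < Num.sqrt K by rewrite sqrtr_gt0.
have etaE' t : (1 <= t <= T)%N ->
    eta t = Num.sqrt K / Num.sqrt (2 * (\sum_(1 <= u < t) ell u + 1)).
  (* Positivity of the rate makes the denominator under the root positive, so the root of the
     quotient splits. *)
  move=> tT; have := eta_gt0 t tT;
    rewrite etaE// sqrtr_gt0 pmulr_rgt0// invr_gt0.
  by move=> X0; rewrite sqrtrM ?ltW// sqrtrV// ltW.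
have sK2 : Num.sqrt K * Num.sqrt K = K by rewrite -expr2 sqr_sqrtr// ltW.
(* With [a = sqrt K], the bound [k i <= K] permits [c = 2 * sqrt K], whence [2 * c ^+ 2 = 8 * K]. *)
have kc : k i / Num.sqrt K + Num.sqrt K <= 2 * Num.sqrt K.
  have : k i / Num.sqrt K <= Num.sqrt K by rewrite ler_pdivrMr// sK2 kK.
  lra.
have S0 : 0 <= 2 * (\sum_(1 <= t < T.+1) s t i + 1).
  rewrite mulr_ge0// addr_ge0// big_nat sumr_ge0// => t; rewrite ltnS => tT.
  by case/andP: (s01 t i tT Ai).
have := fpl_selfconfident k_ge0 kraft q_indep q_exp T_ge1 s01 ellE sK etaE' Ai
  kc.
rewrite [Num.sqrt (_ * K)]sqrtrM// exprMn [Num.sqrt K ^+ 2]expr2 sK2; lra.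
Qed.
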